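(* Let $\mathcal{H}$ be a complex Hilbert space, let $A\in\mathcal{B}(\mathcal{H})$ be positive semidefinite, and let $T\in\mathcal{B}_A(\mathcal{H})$. Then $$dw_A^2(T)\le \sup_{\theta\in\mathbb{R}} w_A^2\left(e^{\mathrm{i}\theta}T+|T|_A^2\right)-2\,c_A(T)\,m_A^2(T).$$
   Context: $\mathcal{B}(\mathcal{H})$ is the algebra of bounded linear operators on the complex Hilbert space $\mathcal{H}$. For a positive semidefinite $A\in\mathcal{B}(\mathcal{H})$, put $\langle x,y\rangle_A=\langle Ax,y\rangle$ and $\|x\|_A=\sqrt{\langle x,x\rangle_A}$. $\mathcal{B}_A(\mathcal{H})$ is the set of $T\in\mathcal{B}(\mathcal{H})$ admitting an $A$-adjoint, i.e. such that $AX=T^*A$ has a solution $X\in\mathcal{B}(\mathcal{H})$; then $T^{\sharp_A}$ denotes the unique solution with $\mathcal{R}(T^{\sharp_A})\subseteq\overline{\mathcal{R}(A)}$ ($\mathcal{R}$ denotes range). Every $T\in\mathcal{B}_A(\mathcal{H})$ is $A$-bounded, i.e. $\|Tx\|_A\le c\|x\|_A$ for all $x$ and some $c>0$. Write $|T|_A^2=T^{\sharp_A}T$. For $A$-bounded $T$: $w_A(T)=\sup\{|\langle Tx,x\rangle_A|:\|x\|_A=1\}$, $c_A(T)=\inf\{|\langle Tx,x\rangle_A|:\|x\|_A=1\}$, $m_A(T)=\inf\{\|Tx\|_A:\|x\|_A=1\}$, and $dw_A(T)=\sup\{\sqrt{|\langle Tx,x\rangle_A|^2+\|Tx\|_A^4}:\|x\|_A=1\}$,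 where $x$ ranges over $\mathcal{H}$. Notation such as $dw_A^2(T)$ means $(dw_A(T))^2$. *)

(* Defs.v *)
From HB Require Import structures.
From mathcomp Require Import all_boot all_order all_algebra.
From mathcomp Require Import all_classical all_reals all_analysis.
From mathcomp Require Import complex.

Set Implicit Arguments.
Unset Strict Implicit.
Unset Printing Implicit Defensive.

Import Order.TTheory GRing.Theory Num.Theory.
Import numFieldNormedType.Exports.
Import ComplexField.Normc.

Local Open Scope classical_set_scope.
Local Open Scope ring_scope.
Local Open Scope complex_scope.

(* A complex Hilbert space: a complete normed module over R[i] whose norm comes
   from an inner product that is linear in its first argument and
   conjugate-linear in its second one. *)
HB.mixin Record isHilbert (R : realType) H & CompleteNormedModule R[i] H := {
  inner : {dot H for (@Num.conj R[i])} ;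
  inner_norm : forall x, inner x x = `|x| ^+ 2
}.

#[short(type="hilbertType")]
HB.structure Definition Hilbert (R : realType) :=
  {H of isHilbert R H & CompleteNormedModule R[i] H}.

Section Operators.
Variables (R : realType) (H : hilbertType R).

Local Notation "''[' u , v ]" := (inner u v) : ring_scope.

Definition bounded_op : set (H -> H) :=
  [set T | linear T /\ exists M : R, forall x, `|T x| <= M%:C * `|x|].

Definition positive_op (A : H -> H) := forall x, 0 <= '[A x, x].

(* The Hilbert adjoint, by unique choice. *)
Definition adjoint (T : H -> H) : H -> H :=
  get [set S | bounded_op S /\ forall x y, '[T x, y] = '[x, S y]].

Definition A_adjoints (A T : H -> H) : set (H -> H) :=
  [set X | bounded_op X /\ A \o X = adjoint T \o A].

Definition bounded_A_op (A : H -> H) : set (H -> H) :=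
  [set T | bounded_op T /\ A_adjoints A T !=set0].

Definition sharp (A T : H -> H) : H -> H :=
  get [set X | A_adjoints A T X /\ range X `<=` closure (range A)].

Definition A_square (A T : H -> H) : H -> H := sharp A T \o T.

Definition A_inner (A : H -> H) (x y : H) : R[i] := '[A x, y].

(* [A_inner A x x] is a nonnegative real when A is positive. *)
Definition A_norm (A : H -> H) (x : H) : R := Num.sqrt (complex.Re (A_inner A x x)).

Definition A_sphere (A : H -> H) : set H := [set x | A_norm A x = 1].

(* Intended for A-bounded T. sup and inf are real-valued, and 0 on set0; the
   A-sphere is empty exactly when A = 0, so all four quantities are then 0. *)
Definition A_numerical_radius (A T : H -> H) : R :=
  sup [set normc (A_inner A (T x) x) | x in A_sphere A].

Definition A_crawford (A T : H -> H) : R :=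
  inf [set normc (A_inner A (T x) x) | x in A_sphere A].

Definition A_min_modulus (A T : H -> H) : R :=
  inf [set A_norm A (T x) | x in A_sphere A].

Definition A_davis_wielandt_radius (A T : H -> H) : R :=
  sup [set Num.sqrt (normc (A_inner A (T x) x) ^+ 2 + A_norm A (T x) ^+ 4)
      | x in A_sphere A].

End Operators.

Definition expi {R : realType} (theta : R) : R[i] := cos theta +i* sin theta.

(* Main.v *)
(* For |x|_A = 1 put z = <Tx, x>_A and n = |Tx|_A. Since <|T|_A^2 x, x>_A = n^2,
   choosing theta with e^(i theta) z = |z| gives
   |<(e^(i theta) T + |T|_A^2) x, x>_A|^2 = (|z| + n^2)^2
     = |z|^2 + n^4 + 2 |z| n^2 >= |z|^2 + n^4 + 2 c_A(T) m_A(T)^2.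
   Adjoints and A-adjoints exist by one Riesz-type theorem: approximate
   representers of a bounded functional on a subspace V, obtained from
   near-minimizers, form a Cauchy sequence, whose limit lies in closure V.
   T is A-bounded by Reid's argument, so that all the suprema are finite. *)

From mathcomp Require Import all_boot all_order all_algebra.
From mathcomp Require Import all_classical all_reals all_analysis.
From mathcomp Require Import complex ring lra.
Require Import Defs.

Set Implicit Arguments.
Unset Strict Implicit.
Unset Printing Implicit Defensive.

Import Order.TTheory GRing.Theory Num.Theory.
Import numFieldNormedType.Exports.
Import ComplexField.Normc.
Local Open Scope classical_set_scope.
Local Open Scope ring_scope.
Local Open Scope complex_scope.

(* Take t = 1 / d; when d = 0 the polynomial is affine. *)
Lemma quadratic_ge0_le (R : realFieldType) (a n d : R) : 0 <= d ->
  (forall t, 0 <= a - 2 * t * n + t ^+ 2 * n * d) -> n <= a * d.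
Proof.
move=> d0 P.
have [d_eq0|d_neq0] := eqVneq d 0.
  rewrite d_eq0 mulr0; apply: contraT; rewrite -ltNge => n_gt0.
  have := P 0; have := P ((a + 1) / n); rewrite d_eq0.
  by rewrite -[2 * _ * n]mulrA divfK ?gt_eqF//; lra.
have d_gt0 : 0 < d by rewrite lt_neqAle eq_sym d_neq0.
rewrite -ler_pdivrMr// -subr_ge0; apply: le_trans (P d^-1) _.
by rewrite le_eqVlt; apply/orP; left; apply/eqP; field.
Qed.

(** * The real-valued modulus on complex numbers *)

Section ComplexNorm.
Variable R : realType.
Implicit Types z w : R[i].

Lemma normr_normc z : `|z| = (normc z)%:C.
Proof. by rewrite normc_def; case: z. Qed.

Lemma normc_ge0 z : 0 <= normc z.
Proof. by case: z => a b; exact: sqrtr_ge0. Qed.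

Lemma normc_real (r : R) : 0 <= r -> normc r%:C = r.
Proof. by move=> r0; rewrite /normc /= expr0n addr0 sqrtr_sqr ger0_norm. Qed.

Lemma sqr_normc_real (r : R) : normc r%:C ^+ 2 = r ^+ 2.
Proof. by rewrite /= expr0n addr0 sqr_sqrtr ?sqr_ge0. Qed.

Lemma normc_conj z : normc z^* = normc z.
Proof. by case: z => a b /=; rewrite sqrrN. Qed.

Lemma mulr_conjc z : z * z^* = (normc z ^+ 2)%:C.
Proof. by rewrite rmorphXn /= -normr_normc sqr_normc. Qed.

Lemma Re_le_normc z : complex.Re z <= normc z.
Proof.
case: z => a b /=; apply: (le_trans (ler_norm a)).
by rewrite -sqrtr_sqr ler_wsqrtr// lerDl sqr_ge0.
Qed.

End ComplexNorm.

Section Inner.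
Variables (R : realType) (H : hilbertType R).
Implicit Types (x y z : H) (c : R[i]).
Local Notation "''[' u , v ]" := (@inner R H u v) : ring_scope.

Lemma innerDl x y z : '[x + y, z] = '[x, z] + '[y, z].
Proof. exact: linearDl. Qed.

Lemma innerDr x y z : '[x, y + z] = '[x, y] + '[x, z].
Proof. exact: linearDr. Qed.

Lemma innerZl c x y : '[c *: x, y] = c * '[x, y].
Proof. exact: linearZl_LR. Qed.

Lemma innerZr c x y : '[x, c *: y] = c^* * '[x, y].
Proof. exact: linearZr_LR. Qed.

Lemma innerC x y : '[y, x] = '[x, y]^*.
Proof. by rewrite hermC expr0 mul1r. Qed.

Lemma innerBl x y z : '[x - y, z] = '[x, z] - '[y, z].
Proof. by rewrite -scaleN1r innerDl innerZl mulN1r. Qed.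

Lemma innerBr x y z : '[x, y - z] = '[x, y] - '[x, z].
Proof. by rewrite -scaleN1r innerDr innerZr rmorphN1 mulN1r. Qed.

End Inner.

Section LinearMaps.
Variables (K : nzRingType) (U V : lmodType K) (T : U -> V).
Hypothesis T_linear : linear T.

Lemma linear_fun0 : T 0 = 0.
Proof. by have := zmod_morphism_linear T_linear 0 0; rewrite !subrr. Qed.

Lemma linear_funD x y : T (x + y) = T x + T y.
Proof. by rewrite -{1}[x]scale1r T_linear scale1r. Qed.

Lemma linear_funZ a x : T (a *: x) = a *: T x.
Proof. by rewrite -{1}[a *: x]addr0 T_linear linear_fun0 addr0. Qed.

End LinearMaps.

(** * The semi-inner product of a positive operator *)

Section PositiveForm.
Variables (R : realType) (H : hilbertType R) (A : H -> H).
Hypotheses (A_linear : linear A) (A_positive : positive_op A).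
Implicit Types (x y z : H) (c : R[i]).

Lemma A_innerDl x y z : A_inner A (x + y) z = A_inner A x z + A_inner A y z.
Proof. by rewrite /A_inner linear_funD// innerDl. Qed.

Lemma A_innerZl c x y : A_inner A (c *: x) y = c * A_inner A x y.
Proof. by rewrite /A_inner linear_funZ// innerZl. Qed.

Lemma A_inner_real x : A_inner A x x = (complex.Re (A_inner A x x))%:C.
Proof.
by have := ger0_Im (A_positive x); rewrite -/(A_inner A x x); case: A_inner => a b /= ->.
Qed.

Lemma A_normE x : A_inner A x x = (A_norm A x ^+ 2)%:C.
Proof.
rewrite /A_norm sqr_sqrtr -?A_inner_real//.
by have := A_positive x; rewrite -/(A_inner A x x) lecE => /andP[].
Qed.

Lemma A_norm_ge0 x : 0 <= A_norm A x.
Proof. exact: sqrtr_ge0. Qed.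

(* Polarization: [A_inner A u u] is real at u = x + y and u = x + i y. *)
Lemma A_innerC x y : A_inner A y x = (A_inner A x y)^*.
Proof.
have := A_inner_real (x + 'i *: y); have := A_inner_real (x + y).
rewrite !A_innerDl !A_innerZl /A_inner !innerDr !innerZr -!/(A_inner A _ _).
rewrite !A_normE.
case: (A_inner A x y) => a b; case: (A_inner A y x) => a' b'.
rewrite /= => -[] /= e1 [] /= e2.
by apply/eqP; rewrite eq_complex /=; apply/andP; split; apply/eqP; lra.
Qed.

Lemma A_normD x y c : A_norm A (x + c *: y) ^+ 2 =
  A_norm A x ^+ 2 + 2 * complex.Re (c^* * A_inner A x y)
  + normc c ^+ 2 * A_norm A y ^+ 2.
Proof.
apply: complexI; rewrite -A_normE A_innerDl A_innerZl /A_inner !innerDr !innerZr.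
rewrite -!/(A_inner A _ _) (A_innerC x y) !A_normE.
case: c => c d; case: (A_inner A x y) => a b.
rewrite /= sqr_sqrtr ?addr_ge0 ?sqr_ge0//.
by apply/eqP; rewrite eq_complex /=; apply/andP; split; apply/eqP => /=; ring.
Qed.

(** With [b] the form at [x] and [y], the squared seminorm of [x - t * b *: y] is a nonnegative
    quadratic in the real variable [t]. [quadratic_ge0_le] also covers [A_norm A y = 0], which can
    happen for nonzero [y]. *)
Lemma A_CauchySchwarz x y :
  normc (A_inner A x y) <= A_norm A x * A_norm A y.
Proof.
set b := A_inner A x y; have b0 := normc_ge0 b.
have x0 := A_norm_ge0 x; have y0 := A_norm_ge0 y.
have P t : 0 <= A_norm A x ^+ 2 - 2 * t * normc b ^+ 2
      + t ^+ 2 * normc b ^+ 2 * A_norm A y ^+ 2.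
  have := sqr_ge0 (A_norm A (x + (- t)%:C * b *: y)).
  rewrite A_normD -/b rmorphM /= -mulrA [_ * b]mulrC mulr_conjc normcM.
  rewrite exprMn sqr_normc_real /= oppr0 mul0r subr0; lra.
rewrite -(@ler_pXn2r _ 2)// ?nnegrE ?mulr_ge0// exprMn.
exact: quadratic_ge0_le (sqr_ge0 _) P.
Qed.

End PositiveForm.

(** * The Hilbert norm as a real-valued function *)

Section HilbertNorm.
Variables (R : realType) (H : hilbertType R).
Implicit Types (x y z : H) (c : R[i]).
Local Notation "''[' u , v ]" := (@inner R H u v) : ring_scope.

(* The norm of H takes its values in R[i]; hnorm is its real-valued form. *)
Definition hnorm x : R := A_norm idfun x.

Lemma idfun_linear : linear (@idfun H). Proof. by []. Qed.

(** At the identity operator the A-form is the inner product itself, so Cauchy-Schwarz and the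
    expansion of squared norms in [H] become instances of the results on positive forms. *)
Lemma idfun_positive : positive_op (@idfun H).
Proof. by move=> x; rewrite /= inner_norm exprn_ge0. Qed.

Lemma normr_hnorm x : `|x| = (hnorm x)%:C.
Proof.
apply/eqP; rewrite -(@eqrXn2 _ 2)// ?ler0c ?A_norm_ge0//.
by rewrite -inner_norm -rmorphXn/= -A_normE//; exact: idfun_positive.
Qed.

Lemma hnorm_ge0 x : 0 <= hnorm x. Proof. exact: A_norm_ge0. Qed.

Lemma hnorm_eq0 x : hnorm x = 0 -> x = 0.
Proof. by move=> x0; apply/eqP; rewrite -normr_eq0 normr_hnorm x0. Qed.

Lemma innerE x : '[x, x] = (hnorm x ^+ 2)%:C.
Proof. exact: (A_normE idfun_positive). Qed.

Lemma inner_CauchySchwarz x y : normc '[x, y] <= hnorm x * hnorm y.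
Proof. exact: (A_CauchySchwarz idfun_linear idfun_positive). Qed.

Lemma hnormD x y c : hnorm (x + c *: y) ^+ 2 =
  hnorm x ^+ 2 + 2 * complex.Re (c^* * '[x, y]) + normc c ^+ 2 * hnorm y ^+ 2.
Proof. exact: (A_normD idfun_linear idfun_positive). Qed.

Lemma hnorm_distC x y : hnorm (x - y) = hnorm (y - x).
Proof. by apply: complexI; rewrite -!normr_hnorm distrC. Qed.

Lemma inner_eq0 x : '[x, x] = 0 -> x = 0.
Proof.
by rewrite innerE => /complexI/eqP; rewrite sqrf_eq0 => /eqP/hnorm_eq0.
Qed.

Lemma inner_inj x y : (forall z, '[z, x] = '[z, y]) -> x = y.
Proof.
by move=> xy; apply/eqP; rewrite -subr_eq0; apply/eqP/inner_eq0; rewrite innerBr xy subrr.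
Qed.

Lemma bounded_opP (T : H -> H) : bounded_op T <->
  linear T /\ exists2 M : R, 0 <= M & forall x, hnorm (T x) <= M * hnorm x.
Proof.
split=> -[Tl [M]]; last first.
  move=> _ TM; split=> //; exists M => x.
  by rewrite !normr_hnorm -rmorphM lecR.
(* The given [M] may be negative when [H] is trivial. *)
move=> TM; split=> //; exists `|M|; first exact: normr_ge0.
move=> x; have := TM x; rewrite !normr_hnorm -rmorphM lecR => /le_trans; apply.
by rewrite ler_wpM2r ?hnorm_ge0 ?ler_norm.
Qed.

Lemma closure_hnormP (V : set H) u : closure V u <->
  forall e : R, 0 < e -> exists2 v, V v & hnorm (u - v) < e.
Proof.
split=> [Vu e e0|Vu B].
  have e0' : 0 < e%:C by rewrite ltcR.
  have [v [Vv]] := Vu _ (nbhsx_ballx u _ e0').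
  rewrite -ball_normE /= normr_hnorm ltcR => uv.
  by exists v.
move=> /nbhs_ballP[e /= e0 uB].
(* Radii of balls in [H] are elements of [R[i]]; positivity makes them real. *)
have eE : e = (complex.Re e)%:C by rewrite RRe_real// gtr0_real.
have [|v Vv uv] := Vu (complex.Re e); first by rewrite -ltcR -eE.
exists v; split=> //; apply: uB.
by rewrite -ball_normE /= normr_hnorm eE ltcR.
Qed.

Lemma hnorm_complete (v : nat -> H) (e : nat -> R) :
    e @ \oo --> (0 : R) ->
    (forall m n, hnorm (v m - v n) <= e m + e n) ->
  exists u, forall r : R, 0 < r -> \forall n \near \oo, hnorm (u - v n) < r.
Proof.
move=> e_cvg v_cauchy.
have : cauchy (v @ \oo).
  apply/cauchy_ballP => r r0.
  have rE : r = (complex.Re r)%:C by rewrite RRe_real// gtr0_real.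
  have r20 : 0 < complex.Re r / 2 by rewrite divr_gt0// -ltcR -rE.
  have e_small : \forall n \near \oo, e n < complex.Re r / 2.
    by move/cvgrPdist_lt : e_cvg => /(_ _ r20); apply: filterS => n;
      rewrite sub0r normrN => /le_lt_trans; apply; rewrite ler_norm.
  rewrite !near_map2; near=> m n.
  rewrite -ball_normE /= normr_hnorm rE ltcR.
  apply: (le_lt_trans (v_cauchy _ _)).
  rewrite [ltRHS]splitr ltrD//.
    by near: m.
  by near: n.
move=> /cauchy_cvgP v_cvg; exists (lim (v @ \oo)) => r r0.
have r0' : 0 < r%:C by rewrite ltcR.
move/cvgrPdist_lt : v_cvg => /(_ _ r0'); apply: filterS => n.
by rewrite normr_hnorm ltcR.
Unshelve. all: by end_near. Qed.

End HilbertNorm.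

(** * Riesz representation on a subspace that need not be closed *)

Section Riesz.
Variables (R : realType) (H : hilbertType R).
Local Notation "''[' u , v ]" := (@inner R H u v) : ring_scope.
Variables (V : set H) (f : H -> R[i]) (M : R).
Hypotheses (V0 : V 0) (V_lin : forall c v w, V v -> V w -> V (v + c *: w)).
Hypothesis f_lin : forall c x y, f (x + c *: y) = f x + c * f y.
Hypothesis f_bounded : forall x, normc (f x) <= M * hnorm x.

(* A near-minimizer of |v|^2 - 2 Re (f v) over V. *)
Lemma riesz_approx (e : R) : 0 < e -> exists2 v, V v &
  forall w, V w -> normc (f w - '[w, v]) <= e * hnorm w.
Proof.
move=> e0; pose J v := hnorm v ^+ 2 - 2 * complex.Re (f v).
(* Completing the square: [J v] is at least [|v|^2 - 2 M |v| = (|v| - M)^2 - M^2]. *)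
have J_lb v : - M ^+ 2 <= J v.
  rewrite /J; have := le_trans (Re_le_normc _) (f_bounded v).
  by have := sqr_ge0 (hnorm v - M); nra.
have J_inf : has_inf (J @` V).
  by split; [exists (J 0), 0 | exists (- M ^+ 2) => _ [v _ <-]; exact: J_lb].
have e20 : 0 < e ^+ 2 by rewrite exprn_gt0.
have [_ [v Vv <-] Jv] := inf_adherent e20 J_inf.
exists v => // w Vw; set a := f w - '[w, v].
rewrite -(@ler_pXn2r _ 2)// ?nnegrE ?normc_ge0 ?mulr_ge0 ?hnorm_ge0 ?(ltW e0)//.
rewrite exprMn; apply: quadratic_ge0_le; first exact: sqr_ge0.
move=> t.
(* Moving from [v] along [t a^* w] changes [J] by [- 2 t |a|^2 + t^2 |a|^2 |w|^2]. As [J v] is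
   within [e ^+ 2] of the infimum, adding [e ^+ 2] to this change gives a nonnegative quadratic in
   [t]. *)
have Jvw : inf (J @` V) <= J (v + (t%:C * a^*) *: w).
  apply: (ge_inf J_inf.2); exists (v + (t%:C * a^*) *: w) => //.
  exact: V_lin.
have : J (v + (t%:C * a^*) *: w) =
    J v - 2 * t * normc a ^+ 2 + t ^+ 2 * normc a ^+ 2 * hnorm w ^+ 2.
  rewrite /J hnormD f_lin normcM exprMn sqr_normc_real normc_conj.
  rewrite (innerC w v) -rmorphM raddfD /=.
  have -> : normc a ^+ 2 = complex.Re (a^* * a) by rewrite mulrC mulr_conjc.
  have -> : f w = a + '[w, v] by rewrite subrK.
  move: (a) => b; case: b => a1 a2; case: '[w, v] => c1 c2; case: (f v) => d1 d2 /=.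
  ring.
lra.
Qed.

Lemma riesz_closure : exists2 u, closure V u & forall w, V w -> f w = '[w, u].
Proof.
have n0 n : 0 < (n.+1%:R^-1 : R) by [].
have /choice[v vP] n : exists v, V v /\
    forall w, V w -> normc (f w - '[w, v]) <= n.+1%:R^-1 * hnorm w.
  by have [v] := riesz_approx (n0 n); exists v.
have VB x y : V x -> V y -> V (x - y).
  by rewrite -scaleN1r; exact: V_lin.
(* Both approximations are tested at [w = v m - v n] itself: subtracting them bounds [|w|^2] by the
   sum of the two errors times [|w|], and [|w|] cancels unless it is zero. *)
have v_cauchy m n : hnorm (v m - v n) <= m.+1%:R^-1 + n.+1%:R^-1.
  have [wm vm] := vP m; have [wn vn] := vP n.
  set w := v m - v n; have Vw : V w by exact: VB.
  have [->|w_neq0] := eqVneq (hnorm w) 0; first by rewrite addr_ge0.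
  have w_gt0 : 0 < hnorm w by rewrite lt_neqAle eq_sym w_neq0 hnorm_ge0.
  rewrite -(ler_pM2r w_gt0) mulrDl.
  apply: le_trans (lerD (vm w Vw) (vn w Vw)).
  rewrite -[normc (f w - '[w, v m])]normcN.
  apply: le_trans (le_normcD _ _).
  have -> : - (f w - '[w, v m]) + (f w - '[w, v n]) = '[w, v m - v n].
    by rewrite innerBr; ring.
  by rewrite innerE normc_real ?sqr_ge0// expr2.
have [u uP] := hnorm_complete (@cvg_harmonic R) v_cauchy.
have u_lim (r : R) : 0 < r -> exists n, hnorm (u - v n) < r /\ (n.+1%:R^-1 : R) < r.
  move=> r0; near \oo => n; exists n; split; near: n; first exact: uP.
  move/cvgrPdist_lt : (@cvg_harmonic R) => /(_ _ r0); apply: filterS => n.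
  by rewrite sub0r normrN => /le_lt_trans; apply; rewrite ler_norm.
exists u.
  apply/closure_hnormP => r r0; have [n [un _]] := u_lim r r0.
  by exists (v n) => //; have [] := vP n.
move=> w Vw; apply/eqP; rewrite -subr_eq0; apply/eqP/eq0_normc/le_anti.
rewrite normc_ge0 andbT; apply/ler_addgt0Pl => r r0; rewrite addr0.
(* With [s = r / (2 |w| + 1)], the error of [v n] and its distance to [u] cost at most [s |w|] each,
   hence less than [r] together. The added 1 keeps the denominator positive when [w = 0]. *)
have w1 : 0 < 2 * hnorm w + 1 by rewrite ltr_wpDl// mulr_ge0// hnorm_ge0.
have [n [un nr]] := u_lim _ (divr_gt0 r0 w1).
have -> : f w - '[w, u] = (f w - '[w, v n]) + '[w, v n - u].
  by rewrite innerBr addrA subrK.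
apply: (le_trans (le_normcD _ _)).
have fw := (vP n).2 w Vw; have wu := inner_CauchySchwarz w (v n - u).
rewrite hnorm_distC in wu.
have w0 := hnorm_ge0 w.
have : r = r / (2 * hnorm w + 1) * (2 * hnorm w + 1) by rewrite divfK ?gt_eqF.
have := divr_gt0 r0 w1.
move: (r / _) un nr => s un nr s0 ->.
apply: (le_trans (lerD fw wu)).
have := ler_wpM2r w0 (ltW nr); have := ler_wpM2l w0 (ltW un).
move: (_^-1 * _) (_ * hnorm (u - _)) => p q; lra.
Unshelve. all: by end_near. Qed.

End Riesz.

(** * Adjoints, orthogonal projections and A-adjoints *)

Section Adjoint.
Variables (R : realType) (H : hilbertType R).
Local Notation "''[' u , v ]" := (@inner R H u v) : ring_scope.
Implicit Types (A T X : H -> H) (V : set H).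

(** [adjoint] is defined by choice, so its properties follow once some adjoint is exhibited; Riesz
    on the whole space supplies one pointwise. *)
Lemma adjointP T : bounded_op T ->
  bounded_op (adjoint T) /\ forall x y, '[T x, y] = '[x, adjoint T y].
Proof.
move=> /bounded_opP[T_lin [M M0 TM]]; rewrite /adjoint.
apply: (@getPex _ [set S | bounded_op S /\ forall x y, '[T x, y] = '[x, S y]]).
have /choice[S TS] (y : H) : exists u, forall x, '[T x, y] = '[x, u].
  have [||||u _ uP] := @riesz_closure R H setT (fun x => '[T x, y]) (M * hnorm y).
  - by [].
  - by [].
  - by move=> c x x'; rewrite linear_funD// linear_funZ// innerDl innerZl.
  - move=> x; apply: le_trans (inner_CauchySchwarz _ _) _.
    by rewrite mulrAC ler_wpM2r ?hnorm_ge0.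
  by exists u => x; exact: (uP x I).
exists S; split=> //; apply/bounded_opP; split=> [c y y'|].
  by apply: inner_inj => x; rewrite -TS !innerDr !innerZr !TS.
(* [T] and [S] share the bound [M]: [|S y|^2 = <T (S y), y>] is at most [M |S y| |y|], and [|S y|]
   cancels if positive. *)
exists M => // y; have := hnorm_ge0 (S y); rewrite le_eqVlt => /predU1P[<-|Sy].
  by rewrite mulr_ge0 ?hnorm_ge0.
rewrite -(ler_pM2l Sy); apply: (@le_trans _ _ (normc '[S y, S y])).
  by rewrite innerE normc_real ?sqr_ge0// expr2.
rewrite -TS; apply: le_trans (inner_CauchySchwarz _ _) _.
by rewrite mulrCA mulrA ler_wpM2r ?hnorm_ge0.
Qed.

Lemma orthogonal_closure V z u :
  (forall v, V v -> '[v, z] = 0) -> closure V u -> '[u, z] = 0.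
Proof.
move=> Vz /closure_hnormP Vu; apply/eq0_normc/le_anti; rewrite normc_ge0 andbT.
apply/ler_addgt0Pl => r r0; rewrite addr0.
have z1 : 0 < hnorm z + 1 by rewrite ltr_wpDl ?hnorm_ge0.
have [v Vv uv] := Vu _ (divr_gt0 r0 z1).
have -> : '[u, z] = '[u - v, z] by rewrite innerBl (Vz v)// subr0.
apply: le_trans (inner_CauchySchwarz _ _) _.
apply: (@le_trans _ _ (hnorm (u - v) * (hnorm z + 1))).
  by rewrite ler_wpM2l ?hnorm_ge0// lerDl.
by rewrite -ler_pdivlMr// ltW.
Qed.

(** The orthogonal projection onto the closure of [V]: [P x] represents the functional [<v, x>]
    restricted to [V]. *)
Lemma closure_projection V : V 0 ->
    (forall c v w, V v -> V w -> V (v + c *: w)) ->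
  exists P, [/\ bounded_op P, range P `<=` closure V &
    forall x v, V v -> '[v, P x] = '[v, x]].
Proof.
move=> V0 V_lin.
have /choice[P PP] (x : H) : exists u, closure V u /\ forall v, V v -> '[v, u] = '[v, x].
  have [||||u Vu uP] := @riesz_closure R H V (fun v => '[v, x]) (hnorm x).
  - exact: V0.
  - exact: V_lin.
  - by move=> c y y'; rewrite innerDl innerZl.
  - by move=> y; rewrite mulrC inner_CauchySchwarz.
  by exists u; split=> // v Vv; rewrite uP.
have cP x u : closure V u -> '[u, P x] = '[u, x].
  move=> Vu; apply/eqP; rewrite -subr_eq0 -innerBr; apply/eqP.
  apply: orthogonal_closure Vu => v Vv.
  by rewrite innerBr (PP x).2// subrr.
have VP x : closure V (P x) := (PP x).1.
exists P; split=> [|_ [x _ <-] //|x v Vv]; last exact: (PP x).2.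
apply/bounded_opP; split=> [c x y|].
  apply/eqP; rewrite -subr_eq0; apply/eqP/inner_eq0.
  set z := P _ - _.
  (* The linearity defect [z] is orthogonal to [closure V] and is also a combination of values of
     [P], all in [closure V]. Hence it is orthogonal to itself. *)
  have zV u : closure V u -> '[u, z] = 0.
    by move=> Vu; rewrite innerBr innerDr innerZr !cP// innerDr innerZr subrr.
  by rewrite {1}/z innerBl innerDl innerZl !zV// mulr0 addr0 subrr.
exists 1 => // x; rewrite mul1r.
have := hnorm_ge0 (P x); rewrite le_eqVlt => /predU1P[<-|Px]; first exact: hnorm_ge0.
rewrite -(ler_pM2l Px); apply: (@le_trans _ _ (normc '[P x, P x])).
  by rewrite innerE normc_real ?sqr_ge0// expr2.
by rewrite cP// inner_CauchySchwarz.
Qed.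

Lemma bounded_op_comp S T : bounded_op S -> bounded_op T -> bounded_op (S \o T).
Proof.
move=> /bounded_opP[S_lin [M M0 SM]] /bounded_opP[T_lin [N N0 TN]].
apply/bounded_opP; split=> [c x y|]; first by rewrite /= T_lin S_lin.
exists (M * N) => [|x]; first exact: mulr_ge0.
by apply: le_trans (SM _) _; rewrite -mulrA ler_wpM2l.
Qed.

Section Sharp.
Variables (A T : H -> H).
Hypotheses (A_bounded : bounded_op A) (A_positive : positive_op A).
Hypothesis T_bounded_A : bounded_A_op A T.

Let A_linear : linear A := A_bounded.1.

(* Composing any A-adjoint X with the projection P onto the closure of range A
   keeps A X, since A P = A. *)
Lemma sharp_A_adjoint : A_adjoints A T (sharp A T).
Proof.
have [_ [X [X_bounded AX]]] := T_bounded_A.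
have [||P [P_bounded rP AP]] := @closure_projection (range A).
- by exists 0 => //; exact: linear_fun0.
- move=> c _ _ [x _ <-] [y _ <-]; exists (x + c *: y) => //.
  by rewrite linear_funD// linear_funZ.
suff : [set X | A_adjoints A T X /\ range X `<=` closure (range A)] (sharp A T).
  by case.
apply: getPex; exists (P \o X); split; last first.
  by move=> _ [x _ <-]; apply: rP; exists (X x).
split; first exact: bounded_op_comp.
rewrite -AX; apply/funext => x /=; apply: inner_inj => y.
(* [P] preserves inner products with [A y]; Hermitian symmetry of the A-form then moves [A] to the
   other argument. *)
have := AP (X x) (A y) (ex_intro2 _ _ y I erefl).
by rewrite !(innerC (A _) y) -!/(A_inner A _ _) -!(A_innerC A_linear A_positive).
Qed.

Lemma A_inner_sharp x y : A_inner A (sharp A T x) y = A_inner A x (T y).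
Proof.
have [_ AX] := sharp_A_adjoint; have [T_bounded _] := T_bounded_A.
have := congr1 (@^~ x) AX; rewrite /A_inner /= => ->.
by rewrite innerC -(adjointP T_bounded).2 -innerC.
Qed.

Lemma A_inner_square x y : A_inner A (A_square A T x) y = A_inner A (T x) (T y).
Proof. exact: A_inner_sharp. Qed.

End Sharp.
End Adjoint.

(** * A-boundedness through iterated squaring *)

Lemma bernoulli (R : realDomainType) (d : R) n : 0 <= d -> 1 + n%:R * d <= (1 + d) ^+ n.
Proof.
move=> d0; elim: n => [|n IHn]; first by rewrite mul0r addr0 expr0.
rewrite exprS -natr1 mulrDl mul1r.
have := ler_wpM2l (addr_ge0 ler01 d0) IHn.
have : 0 <= n%:R * d * d by rewrite !mulr_ge0.
lra.
Qed.

(** The constant [C] disappears under roots of order [2 ^ n]: if [a / K = 1 + d] with [d > 0],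
    Bernoulli makes its powers grow at least like [n d], eventually beyond [C]. *)
Lemma expn2_bound_le (R : archiRealFieldType) (a K C : R) : 0 < K ->
  (forall n, a ^+ (2 ^ n) <= C * K ^+ (2 ^ n)) -> a <= K.
Proof.
move=> K0 aK; rewrite leNgt; apply/negP => Ka.
pose d := a / K - 1.
have d0 : 0 < d by rewrite subr_gt0 ltr_pdivlMr// mul1r.
have dC n : n%:R * d <= C.
  apply: (@le_trans _ _ ((a / K) ^+ (2 ^ n))).
    rewrite [a / K](_ : _ = 1 + d); last by rewrite /d addrC subrK.
    apply: le_trans (bernoulli _ (ltW d0)).
    apply: (@le_trans _ _ ((2 ^ n)%:R * d)); last by rewrite lerDr.
    by rewrite ler_pM2r// ler_nat ltnW// ltn_expl.
  by rewrite expr_div_n ler_pdivrMr ?exprn_gt0// aK.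
have := dC (Num.bound `|C / d|).
rewrite -ler_pdivlMr// leNgt => /negP; apply.
exact: le_lt_trans (ler_norm _) (archi_boundP (normr_ge0 _)).
Qed.

Section ABounded.
Variables (R : realType) (H : hilbertType R) (A T : H -> H).
Hypotheses (A_bounded : bounded_op A) (A_positive : positive_op A).
Hypothesis T_bounded_A : bounded_A_op A T.

Let A_linear : linear A := A_bounded.1.
Let A_square_inner := A_inner_square A_bounded A_positive T_bounded_A.

Lemma A_square_bounded : bounded_op (A_square A T).
Proof.
apply: bounded_op_comp T_bounded_A.1.
exact: (sharp_A_adjoint A_bounded A_positive T_bounded_A).1.
Qed.

(* Reid's argument: S = |T|_A^2 is symmetric for the A-form, so that
   |S^m x|_A^2 = <S^(2m) x, x>_A <= |S^(2m) x|_A on the A-sphere; iterating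
   along m = 2^n, |S x|_A^(2^n) <= C |S|^(2^n) for all n, hence |S x|_A <= |S|. *)
Lemma A_norm_sphere_bounded :
  exists K : R, forall x, A_sphere A x -> A_norm A (T x) ^+ 2 <= K.
Proof.
have /bounded_opP[_ [M M0 AM]] := A_bounded.
have /bounded_opP[_ [N N0 SN]] := A_square_bounded.
(* [N] may be 0, whereas [expn2_bound_le] asks for a positive base. *)
pose S := A_square A T; exists (N + 1) => x x1.
have S_sym y z : A_inner A (S y) z = A_inner A y (S z).
  rewrite A_square_inner (A_innerC A_linear A_positive (S z)) A_square_inner.
  by rewrite -(A_innerC A_linear A_positive).
have iterS_sym m y z : A_inner A (iter m S y) z = A_inner A y (iter m S z).
  by elim: m z => // m IHm z; rewrite iterS S_sym IHm -iterSr.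
have step m : A_norm A (iter m S x) ^+ 2 <= A_norm A (iter (2 * m) S x).
  have -> : A_norm A (iter m S x) ^+ 2 = normc (A_inner A (iter (2 * m) S x) x).
    rewrite mul2n -addnn iterD iterS_sym (A_normE A_positive).
    by rewrite normc_real ?sqr_ge0.
  apply: le_trans (A_CauchySchwarz A_linear A_positive _ _) _.
  by rewrite x1 mulr1.
have steps n : A_norm A (S x) ^+ (2 ^ n) <= A_norm A (iter (2 ^ n) S x).
  elim: n => // n IHn; rewrite expnS mulnC exprM.
  rewrite mulnC; apply: le_trans (step _).
  by rewrite ler_pXn2r// nnegrE ?exprn_ge0// A_norm_ge0.
(* Cauchy-Schwarz gives [|y|_A^2 <= M |y|^2]; the bound [M <= (M + 1)^2] avoids a square root. *)
have A_norm_le y : A_norm A y <= (M + 1) * hnorm y.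
  rewrite -(@ler_pXn2r _ 2)// ?nnegrE ?mulr_ge0 ?addr_ge0 ?hnorm_ge0 ?A_norm_ge0//.
  rewrite -[leLHS]normc_real ?sqr_ge0// -(A_normE A_positive).
  apply: le_trans (inner_CauchySchwarz _ _) _.
  have := ler_wpM2r (hnorm_ge0 y) (AM y).
  have : 0 <= (M ^+ 2 + M + 1) * hnorm y ^+ 2.
    by rewrite mulr_ge0 ?addr_ge0 ?sqr_ge0.
  lra.
have iter_le m : hnorm (iter m S x) <= N ^+ m * hnorm x.
  elim: m => [|m IHm]; first by rewrite expr0 mul1r.
  by rewrite iterS exprS -mulrA; apply: le_trans (SN _) _; rewrite ler_wpM2l.
have Sx : A_norm A (S x) <= N + 1.
  apply: (@expn2_bound_le _ _ _ ((M + 1) * hnorm x)) => [|n].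
    by rewrite ltr_wpDl.
  apply: le_trans (steps n) (le_trans (A_norm_le _) _).
  rewrite -mulrA ler_wpM2l ?addr_ge0//; apply: le_trans (iter_le _) _.
  rewrite mulrC ler_wpM2l ?hnorm_ge0// ler_pXn2r ?expn_gt0// ?nnegrE ?addr_ge0//.
  by rewrite lerDl.
(* On the A-sphere, [|T x|_A^2 = <S x, x>_A] is at most [|S x|_A]. *)
apply: le_trans Sx; rewrite -[leLHS]normc_real ?sqr_ge0// -(A_normE A_positive).
rewrite -A_square_inner; apply: le_trans (A_CauchySchwarz A_linear A_positive _ _) _.
by rewrite x1 mulr1.
Qed.

End ABounded.

(** * Phase rotation and the final inequality *)

Lemma normc_expi (R : realType) (t : R) : normc (expi t) = 1.
Proof. by rewrite /expi /= cos2Dsin2 sqrtr1. Qed.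

Lemma expi_rotation (R : realType) (z : R[i]) :
  exists t, expi t * z = (normc z)%:C.
Proof.
have [z0|z_neq0] := eqVneq (normc z) 0.
  by exists 0; rewrite z0 (eq0_normc z0) mulr0.
suff [t tE] : exists t, expi t = z^* / (normc z)%:C.
  exists t; rewrite tE mulrAC [_ * z]mulrC mulr_conjc rmorphXn /= expr2 mulfK//.
  by rewrite -(rmorph0 (real_complex R)) (inj_eq (@complexI _)).
have r_gt0 : 0 < normc z by rewrite lt_neqAle eq_sym z_neq0 normc_ge0.
case: z r_gt0 {z_neq0} => a b; set r := normc _ => r_gt0.
have rE : r ^+ 2 = a ^+ 2 + b ^+ 2 by rewrite sqr_sqrtr ?addr_ge0 ?sqr_ge0.
have -> : (a +i* b)^* / r%:C = (a / r) +i* (- b / r).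
  rewrite -fmorphV; apply/eqP; rewrite eq_complex /=.
  by apply/andP; split; apply/eqP; ring.
have abs_ar : `|a / r| <= 1.
  rewrite -(@ler_pXn2r _ 2)// ?nnegrE// expr1n real_normK ?num_real//.
  by rewrite expr_div_n rE ler_pdivrMr -?rE ?exprn_gt0// mul1r rE lerDl sqr_ge0.
have ar : -1 <= a / r <= 1 by rewrite -ler_norml.
have sinE : sin (acos (a / r)) = `|b / r|.
  rewrite sin_acos// -sqrtr_sqr; congr Num.sqrt.
  rewrite !expr_div_n; have := exprn_gt0 2 r_gt0; rewrite rE => r2.
  by field; exact: lt0r_neq0.
have cosE : cos (acos (a / r)) = a / r by rewrite acosK// in_itv.
(* [acos] fixes the cosine but always yields a nonnegative sine. The required sine is [- b / r], so
   the sign of [b] decides the sign of the angle. *)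
have [br|br] := leP 0 (b / r).
  by exists (- acos (a / r)); rewrite /expi cosN sinN cosE sinE ger0_norm// mulNr.
by exists (acos (a / r)); rewrite /expi cosE sinE ltr0_norm// mulNr.
Qed.

Theorem theorem2p8 (R : realType) (H : hilbertType R) (A T : H -> H)
    (A_bounded : bounded_op A) (A_positive : positive_op A)
    (T_bounded_A : bounded_A_op A T) :
  A_davis_wielandt_radius A T ^+ 2 <=
    sup [set A_numerical_radius A
               (fun x => expi theta *: T x + A_square A T x) ^+ 2
        | theta in [set: R]]
    - 2 * A_crawford A T * A_min_modulus A T ^+ 2.
Proof.
have A_linear : linear A := A_bounded.1.
have nc0 := @normc_ge0 R.
(* On an empty A-sphere the radii and infima take the default value 0, and the goal becomes
   [0 <= 0]. *)
have [A0|/set0P[x0 Ax0]] := eqVneq (A_sphere A) set0.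
  rewrite /A_davis_wielandt_radius /A_crawford /A_numerical_radius A0.
  rewrite !image_set0 sup0 inf0 expr0n /= mulr0 mul0r subr0.
  under eq_imagel do rewrite image_set0 sup0 expr0n /=.
  by rewrite set_cst; case: ifPn => _; rewrite ?sup0 ?sup1.
have [K TK] := A_norm_sphere_bounded A_bounded A_positive T_bounded_A.
pose z x := A_inner A (T x) x; pose n x := A_norm A (T x).
have n0 x : 0 <= n x := A_norm_ge0 A (T x).
pose S t x := expi t *: T x + A_square A T x.
have formE t x : A_inner A (S t x) x = expi t * z x + (n x ^+ 2)%:C.
  rewrite A_innerDl// A_innerZl// A_inner_square//.
  by rewrite (A_normE A_positive).
have z_le x : A_sphere A x -> normc (z x) <= n x.
  move=> x1; apply: le_trans (A_CauchySchwarz A_linear A_positive _ _) _.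
  by rewrite x1 mulr1.
(* Since [n <= n^2 + 1], one has [|z| + n^2 <= 2 n^2 + 1]. This bound is independent of the angle,
   so it makes both the suprema over the A-sphere and the one over [theta] finite. *)
pose B := 2 * K + 1.
have form_le t x : A_sphere A x -> normc (A_inner A (S t x) x) <= B.
  move=> x1; rewrite formE; apply: le_trans (le_normcD _ _) _.
  rewrite normcM normc_expi mul1r (normc_real (sqr_ge0 _)) /B.
  by have := z_le x x1; have := TK x x1; rewrite -/(n x); have := sqr_ge0 (n x - 1); nra.
have w_ub t x : A_sphere A x ->
    normc (A_inner A (S t x) x) <= A_numerical_radius A (S t).
  move=> x1; apply: ub_le_sup; last by exists x.
  by exists B => _ [y y1 <-]; exact: form_le.
have w_ge0 t : 0 <= A_numerical_radius A (S t).
  exact: le_trans (nc0 _) (w_ub t x0 Ax0).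
have w_le t : A_numerical_radius A (S t) <= B.
  apply: ge_sup; first by exists (normc (A_inner A (S t x0) x0)), x0.
  by move=> _ [y y1 <-]; exact: form_le.
set W := sup _.
have W_ub t : A_numerical_radius A (S t) ^+ 2 <= W.
  apply: ub_le_sup; last by exists t.
  exists (B ^+ 2) => _ [s _ <-].
  by rewrite ler_pXn2r ?nnegrE ?w_ge0 ?w_le ?(le_trans (w_ge0 s) (w_le s)).
have c_le x : A_sphere A x -> A_crawford A T <= normc (z x).
  move=> x1; apply: ge_inf; last by exists x.
  by exists 0 => _ [y _ <-].
(* Nonnegativity of both infima allows their lower bounds to be multiplied below. *)
have c_ge0 : 0 <= A_crawford A T.
  apply: lb_le_inf; first by exists (normc (z x0)), x0.
  by move=> _ [y _ <-].
have m_le x : A_sphere A x -> A_min_modulus A T <= n x.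
  move=> x1; apply: ge_inf; last by exists x.
  by exists 0 => _ [y _ <-]; exact: n0.
have m_ge0 : 0 <= A_min_modulus A T.
  apply: lb_le_inf; first by exists (n x0), x0.
  by move=> _ [y _ <-]; exact: n0.
have pointwise x : A_sphere A x ->
    normc (z x) ^+ 2 + n x ^+ 4 <= W - 2 * A_crawford A T * A_min_modulus A T ^+ 2.
  move=> x1; have [t tE] := expi_rotation (z x).
  have := w_ub t x x1.
  rewrite formE tE -rmorphD normc_real ?addr_ge0 ?sqr_ge0// => sum_le.
  have sum2_le : (normc (z x) + n x ^+ 2) ^+ 2 <= W.
    apply: le_trans (W_ub t).
    by rewrite ler_pXn2r// nnegrE ?addr_ge0 ?sqr_ge0.
  have : A_crawford A T * A_min_modulus A T ^+ 2 <= normc (z x) * n x ^+ 2.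
    apply: ler_pM => //; first exact: sqr_ge0.
      exact: c_le.
    by rewrite ler_pXn2r ?nnegrE//; exact: m_le.
  lra.
set D := W - _ in pointwise *.
(* The radius will be compared with [Num.sqrt D], whose square is [D] only for nonnegative [D]; the
   pointwise bound at [x0] ensures this. *)
have D_ge0 : 0 <= D.
  by apply: le_trans (pointwise x0 Ax0); rewrite addr_ge0 ?sqr_ge0 ?exprn_ge0.
rewrite -[leRHS]sqr_sqrtr// ler_pXn2r ?nnegrE ?sqrtr_ge0//; last first.
  apply: (@le_trans _ _ (Num.sqrt (normc (z x0) ^+ 2 + n x0 ^+ 4))).
    exact: sqrtr_ge0.
  apply: ub_le_sup; last by exists x0.
  by exists (Num.sqrt D) => _ [y y1 <-]; exact/ler_wsqrtr/pointwise.
apply: ge_sup; first by eexists; exists x0.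
by move=> _ [y y1 <-]; exact/ler_wsqrtr/pointwise.
Qed.
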